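(* Let $X$ be a deterministic dynamical system in $\mathsf{Stoch}$ with monoid $M$. An invariant probability measure $p$ on $X$ is ergodic (in the sense that $c\circ p$ is deterministic for every invariant deterministic observable $c:X\to R$) if and only if for every invariant measurable set $A\in\Sigma_X$ we have $p(A)=0$ or $p(A)=1$.
   Context: $\mathsf{Stoch}$ is the category of measurable spaces and Markov kernels $k(B|x)$, with composition $(h\circ k)(C|x)=\int_Y h(C|y)\,k(dy|x)$. A state (morphism from the one-point space $I$) is a probability measure. A kernel $f:X\to Y$ is deterministic if $f(B|x)\in\{0,1\}$ for all $x\in X$, $B\in\Sigma_Y$; in particular a probability measure is deterministic iff it takes only values $0$ and $1$. A dynamical system in $\mathsf{Stoch}$ with monoid $M$ is a measurable space $X$ together with a monoid homomorphism from $M$ to the monoid of Markov kernels $X\to X$; the kernel induced by $m\in M$ is again written $m$. It is deterministic if every $m:X\to X$ is a deterministic kernel. A probability measure $p$ on $X$ is invariant if $\int_X m(A|x)\,p(dx)=p(A)$ for all $m\in M$, $A\in\Sigma_X$. An invariant deterministic observable is a deterministic kernel $c:X\to R$, for some measurable space $R$, with $c\circ m=c$ for all $m\in M$. A set $A\in\Sigma_X$ is invariant if $m(A|x)=1_A(x)$ for all $m\in M$ and $x\in X$. *)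

(* Defs.v *)
From mathcomp Require Import all_boot all_order all_algebra.
From mathcomp Require Import all_classical all_reals all_analysis.

Set Implicit Arguments.
Unset Strict Implicit.
Unset Printing Implicit Defensive.

Local Open Scope classical_set_scope.
Local Open Scope ring_scope.
Local Open Scope ereal_scope.

(* Measures in the library are total on [set T]; their values on non-measurable
   sets are irrelevant.  Hence all equalities of measures and of kernels below
   are taken on measurable sets only, and [measurableType] carries a base point,
   which only excludes the empty space (on which no probability exists). *)

(* [mkcomp_noparam k h x C = \int[k x]_y h y C] is the composite [h o k]:
   the kernel applied first comes first. *)

Section Kernels.
Context (R : realType).

Definition kernel_eq d d' (X : measurableType d) (Y : measurableType d')
    (k h : X -> {measure set Y -> \bar R}) : Prop :=
  forall (x : X) (B : set Y), measurable B -> k x B = h x B.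

Definition deterministic_measure d (X : measurableType d)
    (mu : set X -> \bar R) : Prop :=
  forall A : set X, measurable A -> mu A = 0 \/ mu A = 1.

Definition deterministic_kernel d d' (X : measurableType d)
    (Y : measurableType d') (k : X -> {measure set Y -> \bar R}) : Prop :=
  forall x : X, deterministic_measure (k x).

(* [c o p], where the state [p] is seen as a kernel from the one-point space;
   it unfolds to [fun B => \int[p]_x c x B]. *)
Definition state_comp d d' (X : measurableType d) (Y : measurableType d')
    (c : R.-pker X ~> Y) (p : probability X R) : set Y -> \bar R :=
  kcomp_noparam (fun _ : unit => p) c tt.

Record dynamical_system (M : monoidType) d (X : measurableType d) :=
  DynamicalSystem {
    action :> M -> R.-pker X ~> X;
    action1 : kernel_eq (action 1%g) (fun x => \d_x);
    actionM : forall m n : M,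
      kernel_eq (action (m * n)%g) (mkcomp_noparam (action n) (action m))
  }.

Section System.
Context (M : monoidType) (d : measure_display) (X : measurableType d).
Variable S : dynamical_system M X.

Definition deterministic_system : Prop :=
  forall m : M, deterministic_kernel (S m).

Definition invariant_state (p : probability X R) : Prop :=
  forall (m : M) (A : set X), measurable A -> state_comp (S m) p A = p A.

Definition invariant_observable d' (Y : measurableType d')
    (c : R.-pker X ~> Y) : Prop :=
  forall m : M, kernel_eq (mkcomp_noparam (S m) c) c.

Definition ergodic (p : probability X R) : Prop :=
  forall (d' : measure_display) (Y : measurableType d') (c : R.-pker X ~> Y),
    deterministic_kernel c -> invariant_observable c ->
    deterministic_measure (state_comp c p).

Definition invariant_set (A : set X) : Prop :=
  forall (m : M) (x : X), S m x A = (\1_A x)%:E.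

End System.
End Kernels.

(* Main.v *)
Require Import Defs.
From mathcomp Require Import all_boot all_order all_algebra.
From mathcomp Require Import all_classical all_reals all_analysis.
From mathcomp Require Import measurable_realfun.
Import GRing.Theory.

(** A deterministic kernel [c] into [Y] carries the same information as the map
    sending a measurable [B] of [Y] to the set [sure_set c B] of the points at
    which [B] is almost sure, because [x |-> c x B] is then the indicator of
    that set ([deterministic_kernelE]).  Composing [c] after any measure [mu]
    therefore evaluates [mu] on it ([integral_kernel_indic]).

    Applied to [mu := S m x], this says that invariance of the observable [c]
    is invariance of every [sure_set c B]; applied to [mu := p], it says that
    the law [c o p] gives [B] the mass [p (sure_set c B)].  So a measure that is
    0-1 on invariant sets is ergodic.  Conversely, an invariant set [A] is the
    sure set of [{true}] for the two-valued observable telling whether a point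
    lies in [A]; that observable is invariant because the preimages of the four
    subsets of [bool] are [A], its complement, the empty set and the whole
    space, all of which are invariant. *)

Local Open Scope classical_set_scope.
Local Open Scope ring_scope.
Local Open Scope ereal_scope.

Definition sure_set {d d'} {X : measurableType d} {Y : measurableType d'}
    {R : realType} (c : R.-pker X ~> Y) (B : set Y) : set X :=
  [set x | c x B = 1].

Lemma measurable_sure_set d d' (X : measurableType d) (Y : measurableType d')
    (R : realType) (c : R.-pker X ~> Y) (B : set Y) :
  measurable B -> measurable (sure_set c B).
Proof.
move=> mB; rewrite -[sure_set c B]setTI.
exact: (measurable_kernel c B mB measurableT _ (emeasurable_set1 1)).
Qed.

Lemma deterministic_kernelE d d' (X : measurableType d)
    (Y : measurableType d') (R : realType) (c : R.-pker X ~> Y) (B : set Y) :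
  deterministic_kernel c -> measurable B ->
  forall x, c x B = (\1_(sure_set c B) x)%:E.
Proof.
move=> c_det mB x; rewrite indicE.
have [c0|c1] := c_det x B mB.
- rewrite memNset ?c0// /sure_set/= c0 => /eqP.
  by rewrite eq_sym onee_eq0.
- by rewrite mem_set.
Qed.

(** With [mu] a state this computes [c o p]; with [mu] the kernel [S m x] it
    computes [c o S m]. *)
Lemma integral_kernel_indic d d' (X : measurableType d)
    (Y : measurableType d') (R : realType) (mu : {measure set X -> \bar R})
    (c : X -> {measure set Y -> \bar R}) (A : set X) (B : set Y) :
  measurable A -> (forall x, c x B = (\1_A x)%:E) ->
  \int[mu]_x c x B = mu A.
Proof.
move=> mA cE; rewrite (eq_integral (fun x => (\1_A x)%:E))//.
by rewrite integral_indic// setIT.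
Qed.

Section Membership.
Context {R : realType} {d : measure_display} {X : measurableType d}.

Lemma preimage_membership1 (A : set X) :
  (fun y => y \in A) @^-1` [set true] = A.
Proof. by apply/seteqP; split=> x /=; [exact: set_mem|exact: mem_set]. Qed.

Lemma measurable_fun_membership {A : set X} :
  measurable A -> measurable_fun setT (fun x => x \in A).
Proof.
move=> mA; apply: (measurable_fun_bool true).
by rewrite setTI preimage_membership1.
Qed.

Definition membership_kernel {A : set X} (mA : measurable A) :
  R.-pker X ~> bool := kdirac (measurable_fun_membership mA).

Lemma membership_kernelE (A : set X) (mA : measurable A) (B : set bool) x :
  membership_kernel mA x B = (\1_((fun y => y \in A) @^-1` B) x)%:E.
Proof. by []. Qed.

Lemma deterministic_membership (A : set X) (mA : measurable A) :
  deterministic_kernel (membership_kernel mA).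
Proof.
move=> x B _; rewrite membership_kernelE indicE.
by case: (_ \in _); [right|left].
Qed.

End Membership.

Section InvariantSets.
Context (R : realType) (M : monoidType) (d : measure_display)
  (X : measurableType d) (S : dynamical_system R M X).

(** Each [S m x] is a probability, so its mass off [A] is [1 - \1_A x]. *)
Lemma invariant_setC (A : set X) :
  measurable A -> invariant_set S A -> invariant_set S (~` A).
Proof.
move=> mA A_inv m x.
have mST : S m x setT = 1 by exact: prob_kernel.
have mSA : S m x A \is a fin_num by rewrite A_inv.
have SU : S m x (~` A `|` A) = S m x (~` A) + S m x A.
  by apply: measureU => //; [exact: measurableC|rewrite setICl].
rewrite -[LHS](@addeK _ (S m x A))// -SU setvU mST A_inv -EFinB indicE indicC.
by case: (x \in A); rewrite ?subrr ?subr0.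
Qed.

(** Both sides of [c o S m = c], evaluated at [B], are expressed by the sure
    set: the left one is its [S m x]-mass, the right one its indicator. *)
Lemma invariant_sure_set d' (Y : measurableType d') (c : R.-pker X ~> Y)
    (B : set Y) :
  deterministic_kernel c -> invariant_observable S c -> measurable B ->
  invariant_set S (sure_set c B).
Proof.
move=> c_det c_inv mB m x.
rewrite -deterministic_kernelE// -(c_inv m x B mB); symmetry.
apply: integral_kernel_indic; first exact: measurable_sure_set.
exact: deterministic_kernelE.
Qed.

Lemma invariant_set_preimage_membership (A : set X) (B : set bool) :
  measurable A -> invariant_set S A ->
  invariant_set S ((fun y => y \in A) @^-1` B).
Proof.
move=> mA A_inv.
have [/eqP->|/eqP->|/eqP->|/eqP->] := set_bool B.
- by rewrite preimage_membership1.
- have -> : [set false] = ~` [set true] by apply/seteqP; split=> -[] /=.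
  by rewrite -preimage_setC preimage_membership1; exact: invariant_setC.
- by rewrite preimage_set0 => m x; rewrite measure0 indic0.
- rewrite preimage_setT => m x; rewrite indicT; exact: prob_kernel.
Qed.

(** For any set [B] of answers, [(c o S m) x B] is the [S m x]-mass of the
    preimage of [B], and [c x B] is the indicator of that preimage. *)
Lemma invariant_membership (A : set X) (mA : measurable A) :
  invariant_set S A -> invariant_observable S (membership_kernel mA).
Proof.
move=> A_inv m x B mB; rewrite membership_kernelE.
rewrite -(invariant_set_preimage_membership A B mA A_inv m x).
apply: integral_kernel_indic; last exact: membership_kernelE.
rewrite -[X in measurable X]setTI.
exact: measurable_fun_membership.
Qed.

End InvariantSets.

Theorem corollary3p11 (R : realType) (M : monoidType) (d : measure_display)
    (X : measurableType d) (S : dynamical_system R M X)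
    (S_det : deterministic_system S)
    (p : probability X R) (p_inv : invariant_state S p) :
  ergodic S p <->
  (forall A : set X, measurable A -> invariant_set S A -> p A = 0 \/ p A = 1).
Proof.
split=> [p_erg A mA A_inv|p01 d' Y c c_det c_inv B mB].
- have pA : state_comp (membership_kernel mA) p [set true] = p A.
    apply: integral_kernel_indic => // x.
    by rewrite membership_kernelE preimage_membership1.
  rewrite -pA; apply: p_erg => //.
  + exact: deterministic_membership.
  + exact: invariant_membership.
- have -> : state_comp c p B = p (sure_set c B).
    apply: integral_kernel_indic; first exact: measurable_sure_set.
    exact: deterministic_kernelE.
  apply: p01; first exact: measurable_sure_set.
  exact: invariant_sure_set.
Qed.
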